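(* Let $(\Theta,\mathcal B,\mu_0)$ be a probability space, let $\mathcal G_N,\mathcal G:\Theta\to\mathbb R^m$ ($N\in\mathbb N$) be measurable, let $y\in\mathbb R^m$, and let $\Gamma\in\mathbb R^{m\times m}$ be symmetric positive definite. Define $$\mathcal L_N(\theta)=\tfrac12\bigl|\Gamma^{-1/2}[\mathcal G_N(\theta)-y]\bigr|^2,\qquad \mathcal L(\theta)=\tfrac12\bigl|\Gamma^{-1/2}[\mathcal G(\theta)-y]\bigr|^2 .$$ Suppose that, for real numbers $\delta_N\ge 0$ and a constant $M\ge 0$, $$\|\mathcal G_N-\mathcal G\|_{L^\infty(\mu_0)}\le\delta_N,\qquad\Bigl\|\max\{|\mathcal G_N(\cdot)-y|,\,|\mathcal G(\cdot)-y|\}\Bigr\|_{L^\infty(\mu_0)}\le M .$$ Then $$\|\mathcal L_N-\mathcal L\|_{L^\infty(\mu_0)}\le M\|\Gamma^{-1}\|_2\,\delta_N .$$ Consequently, with $\varepsilon_N=M\|\Gamma^{-1}\|_2\delta_N$, $Z_N=\int_\Theta e^{-\mathcal L_N}\,d\mu_0$, $Z=\int_\Theta e^{-\mathcal L}\,d\mu_0$, $\frac{d\pi_N}{d\mu_0}=Z_N^{-1}e^{-\mathcal L_N}$ and $\frac{d\pi}{d\mu_0}=Z^{-1}e^{-\mathcal L}$, one has $0<Z_N<\infty$, $e^{-\varepsilon_N}\le Z_N/Z\le e^{\varepsilon_N}$, $$\|\pi_N-\pi\|_{\mathrm{TV}}\le\tfrac12\bigl[e^{2\varepsilon_N}-1\bigr],\qquad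 d_{\mathrm{Hell}}(\pi_N,\pi)\le\tfrac1{\sqrt2}\bigl[e^{\varepsilon_N}-1\bigr],$$ and $\bigl|\mathbb E_{\pi_N}[Q]-\mathbb E_\pi[Q]\bigr|\le\|Q\|_{L^\infty}\bigl[e^{2\varepsilon_N}-1\bigr]$ for every bounded measurable $Q:\Theta\to\mathbb R$.
   Context: $|\cdot|$ is the Euclidean norm on $\mathbb R^m$ and $\|\cdot\|_2$ the spectral (operator) norm of a matrix. Total variation is normalized as $\|\pi_N-\pi\|_{\mathrm{TV}}=\frac12\int_\Theta\left|\frac{d\pi_N}{d\mu_0}-\frac{d\pi}{d\mu_0}\right|d\mu_0$, and $$d_{\mathrm{Hell}}^2(\pi_N,\pi)=\frac12\int_\Theta\left[\sqrt{\frac{d\pi_N}{d\mu_0}}-\sqrt{\frac{d\pi}{d\mu_0}}\right]^2\mu_0(d\theta).$$ *)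

(* Defs.v *)
From HB Require Import structures.
From mathcomp Require Import all_boot all_order all_algebra.
From mathcomp Require Import all_classical all_reals all_analysis measurable_realfun.

Set Implicit Arguments.
Unset Strict Implicit.
Unset Printing Implicit Defensive.

Import Order.TTheory GRing.Theory Num.Theory.
Import numFieldNormedType.Exports.

Local Open Scope classical_set_scope.
Local Open Scope ring_scope.

Section euclidean.
Context {R : realType} {m : nat}.

(* The canonical norm [`|v|] on matrices is the sup norm, hence this
   definition. *)
Definition enorm (v : 'cV[R]_m) : R := Num.sqrt (\sum_i v i 0 ^+ 2).

Definition specnorm (A : 'M[R]_m) : R :=
  sup [set enorm (A *m v) | v in [set v : 'cV[R]_m | enorm v <= 1]].

Definition symposdef (A : 'M[R]_m) : Prop :=
  A^T = A /\ forall v : 'cV[R]_m, v != 0 -> 0 < (v^T *m A *m v) 0 0.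

(* The (unique) symmetric positive definite square root of a symmetric positive
   definite matrix; 0 when there is none. *)
Definition sqrtmx (A : 'M[R]_m) : 'M[R]_m :=
  xget 0 [set S : 'M[R]_m | symposdef S /\ S *m S = A].

End euclidean.

Notation borel_cV R m := (g_sigma_algebraType (@open 'cV[R]_m)).

Section misfit.
Context d {Theta : measurableType d} {R : realType} {m : nat}.
Implicit Types (G : Theta -> 'cV[R]_m) (y : 'cV[R]_m) (Gamma : 'M[R]_m).

Definition misfit Gamma y G (t : Theta) : R :=
  2^-1 * enorm (invmx (sqrtmx Gamma) *m (G t - y)) ^+ 2.

Lemma misfit_ge0 Gamma y G t : 0 <= misfit Gamma y G t.
Proof. by rewrite /misfit mulr_ge0 ?invr_ge0 ?ler0n ?sqr_ge0. Qed.

Lemma measurable_coord G i :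
  measurable_fun [set: Theta] (G : Theta -> borel_cV R m) ->
  measurable_fun [set: Theta] (fun t => G t i 0).
Proof.
move=> mG.
have mc : measurable_fun [set: borel_cV R m] (fun v : 'cV[R]_m => v i 0).
  apply: (measurability _ (RGenOpens.measurableE R)) => _ [_ [a [b ->]] <-].
  apply: sub_sigma_algebra; rewrite setTI.
  by apply: open_comp; [move=> x _; exact: coord_continuous|exact: interval_open].
exact: (measurableT_comp mc mG).
Qed.

Lemma measurable_misfit Gamma y G :
  measurable_fun [set: Theta] (G : Theta -> borel_cV R m) ->
  measurable_fun [set: Theta] (misfit Gamma y G).
Proof.
move=> mG; apply: measurable_funM => //.
have -> : (fun t => enorm (invmx (sqrtmx Gamma) *m (G t - y)) ^+ 2) =
    (fun t => \sum_i (\sum_j invmx (sqrtmx Gamma) i j * (G t j 0 - y j 0)) ^+ 2).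
  apply/funext => t; rewrite /enorm sqr_sqrtr; last first.
    by apply: sumr_ge0 => i _; exact: sqr_ge0.
  by apply: eq_bigr => i _; rewrite mxE; congr (_ ^+ 2);
     apply: eq_bigr => j _; rewrite !mxE.
apply: measurable_sum => i; apply: measurable_funX.
apply: measurable_sum => j; apply: measurable_funM => //.
by apply: measurable_funB => //; exact: measurable_coord.
Qed.

End misfit.

Section posterior.
Context d {Theta : measurableType d} {R : realType}.
Variable mu0 : probability Theta R.

Definition evidence (L : Theta -> R) : \bar R :=
  (\int[mu0]_t (expR (- L t))%:E)%E.

Definition posterior_density (L : Theta -> R) (t : Theta) : R :=
  (fine (evidence L))^-1 * expR (- L t).

Variable L : Theta -> R.
Hypothesis mL : measurable_fun [set: Theta] L.
Hypothesis L_ge0 : forall t, 0 <= L t.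

Let mexp : measurable_fun [set: Theta] (fun t => (expR (- L t))%:E).
Proof.
by apply/measurable_EFinP; apply: measurableT_comp => //; exact: measurableT_comp.
Qed.

Lemma evidence_gt0 : (0 < evidence L)%E.
Proof.
rewrite lt0e; apply/andP; split; last first.
  by apply: integral_ge0 => t _; rewrite lee_fin expR_ge0.
apply/eqP => Z0.
have /(ae_eq_integral_abs mu0 measurableT mexp) :
    (\int[mu0]_(t in setT) `|(expR (- L t))%:E| = 0)%E.
  rewrite -[RHS]Z0; apply: eq_integral => t _.
  by rewrite gee0_abs// lee_fin expR_ge0.
case=> A [mA A0 sA].
have : (mu0 [set: Theta] <= mu0 A)%E.
  apply: le_measure; rewrite ?inE// => t _; apply: sA => /= /(_ I)/eqP.
  by rewrite eqe gt_eqF// expR_gt0.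
by rewrite probability_setT [X in (_ <= X)%E -> _]A0 lee_fin ler10.
Qed.

Lemma evidence_le1 : (evidence L <= 1)%E.
Proof.
rewrite -(probability_setT mu0) -[leRHS]mul1e -integral_cst//.
apply: ge0_le_integral => //.
by move=> t _ /=; rewrite lee_fin -expR0 ler_expR oppr_le0.
Qed.

Lemma evidence_fin_num : evidence L \is a fin_num.
Proof.
by rewrite ge0_fin_numE ?(ltW evidence_gt0)// (le_lt_trans evidence_le1)// ltry.
Qed.

(* The unused proof arguments let the probability instance below be inferred. *)
Definition posterior
    of measurable_fun [set: Theta] L & (forall t, 0 <= L t) : set Theta -> \bar R :=
  fun A => (\int[mu0]_(t in A) (posterior_density L t)%:E)%E.

Local Notation post := (posterior mL L_ge0).

Let density_ge0 t : (0 <= (posterior_density L t)%:E)%E.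
Proof.
by rewrite lee_fin mulr_ge0 ?expR_ge0 ?invr_ge0 ?fine_ge0 ?(ltW evidence_gt0).
Qed.

Let mdensity : measurable_fun [set: Theta] (fun t => (posterior_density L t)%:E).
Proof.
apply/measurable_EFinP; apply: measurable_funM => //.
by apply: measurableT_comp => //; exact: measurableT_comp.
Qed.

Let posterior0 : post set0 = 0%E.
Proof. by rewrite /posterior integral_set0. Qed.

Let posterior_ge0 A : (0 <= post A)%E.
Proof. exact: integral_ge0. Qed.

Let posterior_sigma_additive : semi_sigma_additive post.
Proof.
move=> /= F mF tF mUF; rewrite /posterior; apply: cvg_toP.
  apply: ereal_nondecreasing_is_cvgn => a b ab.
  by apply: lee_sum_nneg_natr => // k _ _; exact: integral_ge0.
by rewrite ge0_integral_bigcup//=; exact: measurable_funTS.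
Qed.

HB.instance Definition _ := isMeasure.Build _ _ _ post
  posterior0 posterior_ge0 posterior_sigma_additive.

Let posterior_setT : post [set: Theta] = 1%E.
Proof.
rewrite /posterior; under eq_integral do rewrite EFinM.
rewrite ge0_integralZl//; last first.
  by rewrite lee_fin invr_ge0 fine_ge0// ltW// evidence_gt0.
have Zf := evidence_fin_num; have Z0 := evidence_gt0.
rewrite -/(evidence L) -[X in (_ * X)%E](fineK Zf) -EFinM mulVf//.
by rewrite gt_eqF// fine_gt0// Z0 ltey_eq Zf.
Qed.

HB.instance Definition _ :=
  @Measure_isProbability.Build _ _ R post posterior_setT.

End posterior.

Section distances.
Context d {Theta : measurableType d} {R : realType}.
Variable mu0 : probability Theta R.
Local Open Scope charge_scope.

(* [density nu], [tv_dist] and [hellinger_dist] are meaningful for measures that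
   are absolutely continuous with respect to mu0. *)
Definition density (nu : probability Theta R) : Theta -> \bar R :=
  'd (charge_of_finite_measure nu) '/d mu0.

Local Open Scope ereal_scope.

Definition tv_dist (nu1 nu2 : probability Theta R) : \bar R :=
  2^-1%:E * \int[mu0]_t `|density nu1 t - density nu2 t|.

Definition hellinger_dist (nu1 nu2 : probability Theta R) : \bar R :=
  sqrte (2^-1%:E *
    \int[mu0]_t (sqrte (density nu1 t) - sqrte (density nu2 t)) ^+ 2).

End distances.

(* Main.v *)
Require Import Defs.
From mathcomp Require Import all_boot all_order all_algebra.
From mathcomp Require Import all_classical all_reals all_analysis.
From mathcomp Require Import measurable_realfun ess_sup_inf ring lra.

(** Write [a = GN t - y], [b = G t - y] and [W] for the inverse square root of
    [Gamma].  The misfits are half the quadratic form of [W^T W = Gamma^-1] at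
    [a] and [b], and a difference of quadratic forms splits as
      a^T B a - b^T B b = a^T B (a - b) + (a - b)^T B b.
    By Cauchy-Schwarz and the definition of the operator norm each summand is
    at most [specnorm B * max(|a|, |b|) * |a - b|]; the factor 1/2 absorbs the
    fact that there are two of them ([misfit_dist_le]).  The essential bounds
    on the forward maps therefore give an essential bound [e] on the distance
    of the misfits.

    Everything else holds for any two nonnegative measurable potentials that
    are [e]-close almost everywhere.  The weights [expR (- L1)] and
    [expR (- L2)] agree up to a factor [expR e], hence so do the normalizing
    constants ([fine_evidence_le]), hence the normalized densities [p1], [p2]
    agree up to a factor [expR (2 * e)] in both directions
    ([posterior_density_le]) and their square roots up to [expR e].  Mutual
    domination up to a factor [c] forces a distance of at most [c - 1] times
    either function ([dist_le_of_ratio_le]).  As [p2] has integral 1, a bound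
    of an integrand by a multiple of [p2] bounds its integral by that multiple
    ([integral_le_scaled_posterior_density]); the three distance estimates are
    instances of this.  It remains to identify the Radon-Nikodym derivatives,
    through which the distances are defined, with the explicit densities
    ([density_posterior]). *)

Set Implicit Arguments.
Unset Strict Implicit.
Unset Printing Implicit Defensive.

Import Order.TTheory GRing.Theory Num.Theory.
Import numFieldNormedType.Exports.

Local Open Scope classical_set_scope.
Local Open Scope ring_scope.

(** * Euclidean and operator norms *)

Section euclidean_norm.
Context {R : realType} {m : nat}.
Implicit Types (u v : 'cV[R]_m) (A : 'M[R]_m).

Lemma enorm_ge0 v : 0 <= enorm v.
Proof. exact: sqrtr_ge0. Qed.

Lemma enorm_sqr v : enorm v ^+ 2 = \sum_i v i 0 ^+ 2.
Proof. by rewrite sqr_sqrtr// sumr_ge0// => i _; exact: sqr_ge0. Qed.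

Lemma enorm_sqr_mx v : enorm v ^+ 2 = (v^T *m v) 0 0.
Proof. by rewrite enorm_sqr mxE; apply: eq_bigr => i _; rewrite mxE expr2. Qed.

Lemma enormZ c v : enorm (c *: v) = `|c| * enorm v.
Proof.
rewrite /enorm -sqrtr_sqr -sqrtrM ?sqr_ge0// mulr_sumr.
by congr Num.sqrt; apply: eq_bigr => i _; rewrite mxE exprMn.
Qed.

Lemma enorm0 : enorm (0 : 'cV[R]_m) = 0.
Proof. by rewrite -(scale0r 0) enormZ normr0 mul0r. Qed.

Lemma enorm_eq0 v : enorm v = 0 -> v = 0.
Proof.
move=> v0; have : \sum_i v i 0 ^+ 2 = 0 by rewrite -enorm_sqr v0 expr0n.
move/eqP; rewrite psumr_eq0 => [|i _]; last exact: sqr_ge0.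
move=> /allP v_eq0; apply/colP => i; rewrite mxE; apply/eqP.
by rewrite -sqrf_eq0; apply: v_eq0; rewrite mem_index_enum.
Qed.

(** The sum of the squares of the [U * g i - P * f i], with [P] the inner product
    and [U] the squared norm of [f], is [U] times the defect of the inequality;
    this settles the case [U != 0], and [U = 0] makes all [f i] vanish. *)
Lemma sum_sqr_CauchySchwarz (f g : 'I_m -> R) :
  (\sum_i f i * g i) ^+ 2 <= (\sum_i f i ^+ 2) * (\sum_i g i ^+ 2).
Proof.
set P := \sum_i f i * g i; set U := \sum_i f i ^+ 2; set V := \sum_i g i ^+ 2.
have U_ge0 : 0 <= U by apply: sumr_ge0 => i _; exact: sqr_ge0.
have : 0 <= U * (U * V - P ^+ 2).
  have -> : U * (U * V - P ^+ 2) = \sum_i (U * g i - P * f i) ^+ 2.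
    transitivity (\sum_i (U ^+ 2 * g i ^+ 2 - 2 * U * P * (f i * g i)
                          + P ^+ 2 * f i ^+ 2)).
      by rewrite big_split sumrB -!mulr_sumr /= -/U -/V -/P; ring.
    by apply: eq_bigr => i _; ring.
  by apply: sumr_ge0 => i _; exact: sqr_ge0.
have [U0 _|U_neq0] := eqVneq U 0; last first.
  by rewrite pmulr_rge0 ?subr_ge0// lt_def U_neq0.
rewrite U0 mul0r /P big1 ?expr0n// => i _.
have /eqP := U0; rewrite psumr_eq0 => [|j _]; last exact: sqr_ge0.
move=> /allP/(_ i); rewrite mem_index_enum => /(_ isT).
by rewrite sqrf_eq0 => /eqP ->; rewrite mul0r.
Qed.

Lemma dotmx_le_enorm u v : `|(u^T *m v) 0 0| <= enorm u * enorm v.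
Proof.
rewrite -(@ler_pXn2r _ 2)// ?nnegrE ?mulr_ge0 ?enorm_ge0//.
rewrite real_normK ?num_real// exprMn !enorm_sqr mxE.
under eq_bigr do rewrite mxE.
exact: (sum_sqr_CauchySchwarz (u ^~ 0) (v ^~ 0)).
Qed.

(** The crude row-by-row bound that makes the supremum defining [specnorm] a
    supremum of a bounded set. *)
Lemma enorm_mulmx_le_frobenius A v :
  enorm (A *m v) <= Num.sqrt (\sum_i \sum_j A i j ^+ 2) * enorm v.
Proof.
rewrite /enorm -sqrtrM; last by do 2!apply: sumr_ge0 => ? _; exact: sqr_ge0.
apply: ler_wsqrtr; rewrite mulr_suml; apply: ler_sum => i _; rewrite mxE.
exact: (sum_sqr_CauchySchwarz (A i) (v ^~ 0)).
Qed.

Lemma enorm_le_specnorm A v : enorm v <= 1 -> enorm (A *m v) <= specnorm A.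
Proof.
move=> v1; apply: ub_le_sup; last by exists v.
exists (Num.sqrt (\sum_i \sum_j A i j ^+ 2)) => _ [x /= x1 <-].
by rewrite (le_trans (enorm_mulmx_le_frobenius A x))// ler_piMr// sqrtr_ge0.
Qed.

Lemma specnorm_ge0 A : 0 <= specnorm A.
Proof.
rewrite (le_trans (enorm_ge0 (A *m 0)))// enorm_le_specnorm//.
by rewrite enorm0.
Qed.

Lemma enorm_mulmx_le A v : enorm (A *m v) <= specnorm A * enorm v.
Proof.
have [v0|v_neq0] := eqVneq (enorm v) 0.
  by rewrite (enorm_eq0 v0) mulmx0 enorm0 mulr0.
have v_gt0 : 0 < enorm v by rewrite lt_def v_neq0 enorm_ge0.
have := @enorm_le_specnorm A ((enorm v)^-1 *: v).
rewrite -scalemxAr !enormZ ger0_norm ?invr_ge0 ?enorm_ge0// mulVf//.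
by move=> /(_ (lexx _)); rewrite mulrC ler_pdivrMr.
Qed.

Lemma bilinear_le_specnorm A u v :
  `|(u^T *m A *m v) 0 0| <= specnorm A * (enorm u * enorm v).
Proof.
rewrite -mulmxA (le_trans (dotmx_le_enorm _ _))//.
by rewrite mulrCA ler_wpM2l ?enorm_ge0// enorm_mulmx_le.
Qed.

(** Obtained by inserting the mixed term [u^T *m A *m v]: each summand has the
    difference [u - v] as one factor, so closeness of [u] and [v] makes it small. *)
Lemma quadratic_formB A u v :
  (u^T *m A *m u) 0 0 - (v^T *m A *m v) 0 0 =
  (u^T *m A *m (u - v)) 0 0 + ((u - v)^T *m A *m v) 0 0.
Proof.
have : u^T *m A *m u - v^T *m A *m v =
    u^T *m A *m (u - v) + (u - v)^T *m A *m v.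
  by rewrite mulmxBr linearB/= !mulmxBl addrA subrK.
have entryD (X Y : 'M[R]_1) : (X + Y) 0 0 = X 0 0 + Y 0 0 by rewrite mxE.
have entryB (X Y : 'M[R]_1) : (X - Y) 0 0 = X 0 0 - Y 0 0 by rewrite !mxE.
by rewrite -entryB -entryD => ->.
Qed.

Lemma symposdef_unitmx A : symposdef A -> A \in unitmx.
Proof.
move=> [_ Apos]; rewrite -row_free_unit; apply: inj_row_free => v vA0.
apply/eqP/negP => /negP; rewrite -trmx_eq0 => /Apos.
by rewrite trmxK vA0 mul0mx mxE ltxx.
Qed.

(** Only the Gram matrix of the whitening matrix enters the misfit.  The second
    alternative is the default value of [sqrtmx], for which the misfit vanishes
    identically. *)
Lemma invmx_sqrtmx_gram A :
  let W := invmx (sqrtmx A) in W^T *m W = invmx A \/ W = 0.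
Proof.
rewrite /sqrtmx; case: xgetP => [S _ [S_spd SS]|_] /=; last first.
  (* If the zero matrix is invertible then the dimension is 0 and 1 = 0. *)
  right; rewrite /invmx; case: ifPn => // u0.
  by rewrite -[LHS]mulmx1 -(mulVmx u0) !mulmx0.
left; have Su := symposdef_unitmx S_spd.
rewrite trmx_inv (proj1 S_spd).
have Au : A \in unitmx by rewrite -SS unitmx_mul Su.
apply: (can_inj (mulmxK Au)).
by rewrite mulVmx// -SS -mulmxA (mulmxA _ S) mulVmx// mul1mx mulVmx.
Qed.

End euclidean_norm.

(** * Lipschitz estimate for the misfit *)

(** The two misfits are quadratic forms of one matrix, so their difference is
    controlled by [quadratic_formB] and the operator norm of [invmx Gamma]. *)
Lemma misfit_dist_le d (Theta : measurableType d) (R : realType) (m : nat)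
    (Gamma : 'M[R]_m) (y : 'cV[R]_m) (G1 G2 : Theta -> 'cV[R]_m) t :
  `|misfit Gamma y G1 t - misfit Gamma y G2 t| <=
  Num.max (enorm (G1 t - y)) (enorm (G2 t - y)) * specnorm (invmx Gamma)
    * enorm (G1 t - G2 t).
Proof.
rewrite /misfit !enorm_sqr_mx !trmx_mul.
set W := invmx (sqrtmx Gamma); set B := invmx Gamma.
set a := G1 t - y; set b := G2 t - y; set D := G1 t - G2 t.
set mx := Num.max _ _.
have mx_ge0 : 0 <= mx by rewrite le_max enorm_ge0.
(* Reassociate so that both quadratic forms display the Gram matrix of [W]. *)
rewrite !mulmxA -2!(mulmxA _ W^T W).
have [->|->] : W^T *m W = B \/ W = 0 := invmx_sqrtmx_gram Gamma; last first.
  rewrite !mulmx0 !mul0mx !mxE subrr normr0 mulr_ge0 ?enorm_ge0// mulr_ge0//.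
  exact: specnorm_ge0.
have -> : 2^-1 * (a^T *m B *m a) 0 0 - 2^-1 * (b^T *m B *m b) 0 0 =
    2^-1 * ((a^T *m B *m D) 0 0 + (D^T *m B *m b) 0 0).
  rewrite -mulrBr quadratic_formB.
  by have -> : a - b = D by rewrite /a /b opprB addrA subrK.
have aD : `|(a^T *m B *m D) 0 0| <= specnorm B * (mx * enorm D).
  rewrite (le_trans (bilinear_le_specnorm _ _ _))// ler_wpM2l ?specnorm_ge0//.
  by rewrite ler_wpM2r ?enorm_ge0// le_max lexx.
have Db : `|(D^T *m B *m b) 0 0| <= specnorm B * (mx * enorm D).
  rewrite (le_trans (bilinear_le_specnorm _ _ _))// ler_wpM2l ?specnorm_ge0//.
  by rewrite mulrC ler_wpM2r ?enorm_ge0// le_max lexx orbT.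
rewrite normrM ger0_norm ?invr_ge0// ler_pdivrMl//.
rewrite (le_trans (ler_normD _ _))// (le_trans (lerD aD Db))//.
by rewrite le_eqVlt; apply/orP; left; apply/eqP; ring.
Qed.

(** * Densities of the posteriors *)

(** If [x >= y] the first ratio bound gives the claim; if [x <= y] the second one
    gives [y - x <= (c - 1) * x], and [x <= y]. *)
Lemma dist_le_of_ratio_le (R : realFieldType) (c x y : R) :
  1 <= c -> 0 <= x -> x <= c * y -> y <= c * x -> `|x - y| <= (c - 1) * y.
Proof. by move=> c1 x0 xy yx; rewrite ler_norml; apply/andP; split; nra. Qed.

Section density.
Context d {Theta : measurableType d} {R : realType}.
Variables mu0 nu : probability Theta R.
Hypothesis nu_mu0 : nu `<< mu0.

Lemma density_fin_num t : density mu0 nu t \is a fin_num.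
Proof. exact: Radon_Nikodym_fin_num. Qed.

Lemma measurable_density : measurable_fun [set: Theta] (density mu0 nu).
Proof. by apply: measurable_int; exact: Radon_Nikodym_integrable. Qed.

End density.

Section posterior_density.
Context d {Theta : measurableType d} {R : realType}.
Variable mu0 : probability Theta R.
Variable L : Theta -> R.
Hypothesis mL : measurable_fun [set: Theta] L.
Hypothesis L_ge0 : forall t, 0 <= L t.

Local Notation post := (posterior mu0 mL L_ge0).
Local Notation p := (posterior_density mu0 L).

Lemma fine_evidence_gt0 : 0 < fine (evidence mu0 L).
Proof.
by rewrite fine_gt0// evidence_gt0//= ltey_eq evidence_fin_num.
Qed.

Lemma posterior_density_gt0 t : 0 < p t.
Proof. by rewrite mulr_gt0 ?expR_gt0// invr_gt0 fine_evidence_gt0. Qed.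

Lemma measurable_posterior_density : measurable_fun [set: Theta] p.
Proof.
apply: measurable_funM => //.
by apply: measurableT_comp => //; exact: measurableT_comp.
Qed.

Lemma integral_posterior_density : (\int[mu0]_t (p t)%:E = 1)%E.
Proof. exact: (probability_setT post). Qed.

Lemma integrable_posterior_density : mu0.-integrable setT (EFin \o p).
Proof.
apply/integrableP; split.
  by apply/measurable_EFinP; exact: measurable_posterior_density.
under eq_integral do rewrite gee0_abs ?lee_fin ?ltW ?posterior_density_gt0//.
by rewrite integral_posterior_density ltry.
Qed.

Lemma posterior_null_dominates : post `<< mu0.
Proof.
apply/null_content_dominatesP => A mA A0; apply: null_set_integral => //.
by apply/measurable_EFinP/measurable_funTS/measurable_posterior_density.
Qed.

(** Both functions have the integral [post A] over every measurable set [A]. *)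
Lemma density_posterior : ae_eq mu0 setT (density mu0 post) (EFin \o p).
Proof.
have dom := posterior_null_dominates.
apply: integral_ae_eq => //; first exact: Radon_Nikodym_integrable.
  by apply/measurable_EFinP; exact: measurable_posterior_density.
by move=> A _ mA; rewrite -Radon_Nikodym_integral.
Qed.

Lemma integral_posterior (f : Theta -> \bar R) : post.-integrable setT f ->
  (\int[post]_t f t = \int[mu0]_t (f t * (p t)%:E))%E.
Proof.
move=> intf; have mf := measurable_int _ intf.
rewrite -(@Radon_Nikodym_change_of_variables _ _ _ post mu0)//; last first.
  exact: posterior_null_dominates.
apply: ae_eq_integral => //.
- apply: emeasurable_funM => //.
  exact/measurable_density/posterior_null_dominates.
- apply: emeasurable_funM => //; apply/measurable_EFinP.
  exact: measurable_posterior_density.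
- exact: (ae_eqe_mul2l _ density_posterior).
Qed.

End posterior_density.

(** * Comparison of posteriors with close potentials *)

Lemma measurable_sqrt (R : realType) : measurable_fun [set: R] (@Num.sqrt R).
Proof. exact: continuous_measurable_fun (@sqrt_continuous R). Qed.

(** The norm at [+oo] is an essential supremum because the total mass of [mu]
    is positive. *)
Lemma Lnorm_inftyP d (T : measurableType d) (R : realType)
    (mu : probability T R) (f : T -> R) (M : \bar R) :
  ('N[mu]_+oo[EFin \o f] <= M)%E <-> {ae mu, forall t, (`|f t|%:E <= M)%E}.
Proof.
by rewrite Lnorm.unlock /= probability_setT lte01; split => /ess_supP.
Qed.

Section comparison.
Context d {Theta : measurableType d} {R : realType}.
Variable mu0 : probability Theta R.

Lemma fine_evidence_le (L1 L2 : Theta -> R) (e : R) :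
  measurable_fun [set: Theta] L1 -> measurable_fun [set: Theta] L2 ->
  (forall t, 0 <= L1 t) -> (forall t, 0 <= L2 t) ->
  {ae mu0, forall t, `|L1 t - L2 t| <= e} ->
  fine (evidence mu0 L1) <= expR e * fine (evidence mu0 L2).
Proof.
move=> mL1 mL2 L1_ge0 L2_ge0 close.
have mexp (L : Theta -> R) : measurable_fun setT L ->
    measurable_fun [set: Theta] (fun t => (expR (- L t))%:E).
  move=> mL; apply/measurable_EFinP.
  by apply: measurableT_comp => //; exact: measurableT_comp.
rewrite -lee_fin EFinM !fineK ?evidence_fin_num//.
rewrite -ge0_integralZl ?lee_fin ?expR_ge0//; last exact: mexp.
apply: ae_ge0_le_integral => //.
- exact: mexp.
- by apply: emeasurable_funM => //; exact: mexp.
apply: filterS close => t; rewrite ler_norml => /andP[L12 _] _.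
by rewrite lee_fin -expRD ler_expR; lra.
Qed.

(** One factor [expR e] comes from the weights, the other from the normalizing
    constants, which are compared in the opposite direction. *)
Lemma posterior_density_le (L1 L2 : Theta -> R) (e : R) :
  measurable_fun [set: Theta] L1 -> measurable_fun [set: Theta] L2 ->
  (forall t, 0 <= L1 t) -> (forall t, 0 <= L2 t) ->
  {ae mu0, forall t, `|L1 t - L2 t| <= e} ->
  {ae mu0, forall t,
    posterior_density mu0 L1 t <= expR (2 * e) * posterior_density mu0 L2 t}.
Proof.
move=> mL1 mL2 L1_ge0 L2_ge0 close.
have close' : {ae mu0, forall t, `|L2 t - L1 t| <= e}.
  by apply: filterS close => t; rewrite distrC.
have Z21 := fine_evidence_le mL2 mL1 L2_ge0 L1_ge0 close'.
have Z1_gt0 := fine_evidence_gt0 mu0 mL1 L1_ge0.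
have Z2_gt0 := fine_evidence_gt0 mu0 mL2 L2_ge0.
apply: filterS close => t; rewrite ler_norml => /andP[L12 _].
rewrite /posterior_density mulrC [leRHS]mulrCA ler_pdivrMr//.
rewrite -(ler_pM2l Z2_gt0).
have E12 : expR (- L1 t) <= expR e * expR (- L2 t).
  by rewrite -expRD ler_expR; lra.
have -> : expR (2 * e) = expR e * expR e by rewrite expRM_natl expr2.
rewrite -(mulrA _^-1) mulVKf ?gt_eqF//.
rewrite (le_trans (ler_pM (ltW Z2_gt0) (expR_ge0 _) Z21 E12))//.
by rewrite le_eqVlt; apply/orP; left; apply/eqP; ring.
Qed.

Variables (L1 L2 : Theta -> R) (e : R).
Hypothesis mL1 : measurable_fun [set: Theta] L1.
Hypothesis mL2 : measurable_fun [set: Theta] L2.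
Hypothesis L1_ge0 : forall t, 0 <= L1 t.
Hypothesis L2_ge0 : forall t, 0 <= L2 t.
Hypothesis e_ge0 : 0 <= e.
Hypothesis close : {ae mu0, forall t, `|L1 t - L2 t| <= e}.

Local Notation post1 := (posterior mu0 mL1 L1_ge0).
Local Notation post2 := (posterior mu0 mL2 L2_ge0).
Local Notation p1 := (posterior_density mu0 L1).
Local Notation p2 := (posterior_density mu0 L2).

Let close' : {ae mu0, forall t, `|L2 t - L1 t| <= e}.
Proof. by apply: filterS close => t; rewrite distrC. Qed.

Lemma evidence_ratio_bounds :
  expR (- e) <= fine (evidence mu0 L1) / fine (evidence mu0 L2) <= expR e.
Proof.
have Z2_gt0 := fine_evidence_gt0 mu0 mL2 L2_ge0.
rewrite ler_pdivlMr// ler_pdivrMr// expRN ler_pdivrMl ?expR_gt0//.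
by rewrite !fine_evidence_le.
Qed.

Lemma posterior_density_dist :
  {ae mu0, forall t, `|p1 t - p2 t| <= (expR (2 * e) - 1) * p2 t}.
Proof.
apply: filterS2 (posterior_density_le mL1 mL2 L1_ge0 L2_ge0 close)
  (posterior_density_le mL2 mL1 L2_ge0 L1_ge0 close') => t p12 p21.
apply: dist_le_of_ratio_le p12 p21; first by rewrite -expR0 ler_expR mulr_ge0.
exact/ltW/posterior_density_gt0.
Qed.

(** Taking square roots halves the exponent: the ratio of the square roots is at
    most [expR e], which is why [2 * e] does not appear. *)
Lemma sqrt_posterior_density_dist :
  {ae mu0, forall t,
    (Num.sqrt (p1 t) - Num.sqrt (p2 t)) ^+ 2 <= (expR e - 1) ^+ 2 * p2 t}.
Proof.
have expR2e : expR (2 * e) = expR e ^+ 2 by rewrite expRM_natl.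
have sqrt_le x y : x <= expR (2 * e) * y -> Num.sqrt x <= expR e * Num.sqrt y.
  move=> xy; rewrite -(ger0_norm (expR_ge0 e)) -sqrtr_sqr -sqrtrM ?sqr_ge0//.
  by rewrite -expR2e ler_wsqrtr.
apply: filterS2 (posterior_density_le mL1 mL2 L1_ge0 L2_ge0 close)
  (posterior_density_le mL2 mL1 L2_ge0 L1_ge0 close').
move=> t /sqrt_le p12 /sqrt_le p21.
have p2_ge0 : 0 <= p2 t by exact/ltW/posterior_density_gt0.
rewrite -{2}(sqr_sqrtr p2_ge0) -exprMn -real_normK ?num_real//.
have e1 : 1 <= expR e by rewrite -expR0 ler_expR.
rewrite lerXn2r// ?nnegrE ?mulr_ge0 ?subr_ge0 ?sqrtr_ge0//.
by apply: dist_le_of_ratio_le p12 p21 => //; exact: sqrtr_ge0.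
Qed.

(** The posterior density [p2] has integral 1, so pointwise bounds proportional
    to it integrate without loss. *)
Lemma integral_le_scaled_posterior_density (f : Theta -> \bar R) (c : R) :
  0 <= c -> measurable_fun setT f -> (forall t, 0 <= f t)%E ->
  {ae mu0, forall t, (f t <= (c * p2 t)%:E)%E} -> (\int[mu0]_t f t <= c%:E)%E.
Proof.
move=> c_ge0 mf f_ge0 fp.
have mp := measurable_posterior_density mu0 mL2.
have p_ge0 t : (0 <= (p2 t)%:E)%E.
  by rewrite lee_fin ltW// posterior_density_gt0.
have -> : (c%:E = \int[mu0]_t (c * p2 t)%:E)%E.
  under eq_integral do rewrite EFinM.
  rewrite ge0_integralZl ?lee_fin//; last exact/measurable_EFinP.
  by rewrite (integral_posterior_density _ mL2 L2_ge0) mule1.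
apply: ae_ge0_le_integral => //.
- by move=> t _; rewrite EFinM mule_ge0// lee_fin.
- by apply/measurable_EFinP; exact: measurable_funM.
- by apply: filterS fp => t ft _.
Qed.

Lemma tv_dist_posterior_le :
  (tv_dist mu0 post1 post2 <= (2^-1 * (expR (2 * e) - 1))%:E)%E.
Proof.
have c_ge0 : 0 <= expR (2 * e) - 1.
  by rewrite subr_ge0 -expR0 ler_expR mulr_ge0.
rewrite /tv_dist EFinM lee_wpmul2l ?lee_fin ?invr_ge0//.
apply: integral_le_scaled_posterior_density => //.
- apply: measurableT_comp => //.
  by apply: emeasurable_funB; apply: measurable_density;
    exact: posterior_null_dominates.
- apply: filterS3 (density_posterior _ mL1 L1_ge0)
    (density_posterior _ mL2 L2_ge0) posterior_density_dist.
  by move=> t /(_ I) -> /(_ I) -> /=; rewrite lee_fin.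
Qed.

(** The squared distance is half an integral to which
    [integral_le_scaled_posterior_density] applies with the constant
    [(expR e - 1) ^+ 2]; monotonicity of the square root concludes. *)
Lemma hellinger_dist_posterior_le :
  (hellinger_dist mu0 post1 post2 <=
    ((Num.sqrt 2)^-1 * (expR e - 1))%:E)%E.
Proof.
have c_ge0 : 0 <= expR e - 1 by rewrite subr_ge0 -expR0 ler_expR.
have -> : (Num.sqrt 2)^-1 * (expR e - 1) =
    Num.sqrt (2^-1 * (expR e - 1) ^+ 2) :> R.
  by rewrite sqrtrM ?invr_ge0// sqrtr_sqr ger0_norm// sqrtrV.
rewrite /hellinger_dist -[leRHS]/(sqrte (2^-1 * (expR e - 1) ^+ 2)%:E).
rewrite lee_sqrt; last by rewrite lee_fin mulr_ge0 ?invr_ge0 ?sqr_ge0.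
rewrite EFinM lee_wpmul2l ?lee_fin ?invr_ge0//.
have dom1 := posterior_null_dominates mL1 L1_ge0.
have dom2 := posterior_null_dominates mL2 L2_ge0.
(* The Radon-Nikodym derivatives are finite everywhere, so the extended square
   roots and their difference are real ones. *)
pose r1 t := fine (density mu0 post1 t); pose r2 t := fine (density mu0 post2 t).
have r1E t : density mu0 post1 t = (r1 t)%:E.
  by rewrite fineK// density_fin_num.
have r2E t : density mu0 post2 t = (r2 t)%:E.
  by rewrite fineK// density_fin_num.
under eq_integral do rewrite r1E r2E /= -EFinB -EFinM -expr2.
have msqrt (nu : probability Theta R) : nu `<< mu0 ->
    measurable_fun setT (fun t => Num.sqrt (fine (density mu0 nu t))).
  move=> dom; apply: measurableT_comp; first exact: measurable_sqrt.
  by apply: measurableT_comp => //; exact: measurable_density.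
apply: integral_le_scaled_posterior_density; first exact: sqr_ge0.
- apply/measurable_EFinP; apply: measurable_funX.
  by apply: measurable_funB; exact: msqrt.
- by move=> t; rewrite lee_fin sqr_ge0.
- apply: filterS3 (density_posterior _ mL1 L1_ge0)
    (density_posterior _ mL2 L2_ge0) sqrt_posterior_density_dist.
  by move=> t /(_ I) d1 /(_ I) d2; rewrite /r1 /r2 d1 d2 /= lee_fin.
Qed.

(** The difference of the expectations is the integral of [Q * (p1 - p2)] with
    respect to [mu0], and [Q] is essentially bounded by its norm at [+oo]. *)
Lemma expectation_posterior_dist_le (Q : Theta -> R) :
  measurable_fun [set: Theta] Q -> bounded_fun Q ->
  (`| 'E_post1[Q] - 'E_post2[Q] | <=
     'N[mu0]_+oo[EFin \o Q] * (expR (2 * e) - 1)%:E)%E.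
Proof.
move=> mQ bQ.
(* The pointwise bound [M] serves to make the essential one finite. *)
have [M _ QM] := ex_strict_bound_gt0 bQ.
set q := ('N[mu0]_+oo[EFin \o Q])%E.
have q_ge0 : (0 <= q)%E by exact: Lnorm_ge0.
have q_le : (q <= M%:E)%E.
  by apply/Lnorm_inftyP; apply: nearW => t; rewrite lee_fin ltW// QM.
have qE : q = (fine q)%:E.
  by rewrite fineK// ge0_fin_numE// (le_lt_trans q_le)// ltry.
have Qq : {ae mu0, forall t, `|Q t| <= fine q}.
  have /Lnorm_inftyP : (q <= q)%E by [].
  by apply: filterS => t; rewrite {1}qE lee_fin.
have intQ (nu : probability Theta R) : nu.-integrable setT (EFin \o Q).
  by apply: measurable_bounded_integrable => //; rewrite ltey_eq fin_num_measure.
have intQp (L : Theta -> R) : measurable_fun setT L -> (forall t, 0 <= L t) ->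
    mu0.-integrable setT (fun t => ((Q t)%:E * (posterior_density mu0 L t)%:E)%E).
  move=> mL L_ge0; under eq_fun do rewrite muleC.
  exact: (integrableMl measurableT (integrable_posterior_density _ mL L_ge0)).
rewrite unlock !integral_posterior// -integralB//; last 2 first.
- exact: intQp.
- exact: intQp.
have m12 : measurable_fun setT (fun t => (Q t * (p1 t - p2 t))%:E).
  apply/measurable_EFinP; apply: measurable_funM => //.
  by apply: measurable_funB; exact: measurable_posterior_density.
under eq_integral do rewrite -!EFinM -EFinB -mulrBr.
rewrite (le_trans (le_abse_integral _ _ _))// qE -EFinM.
have c_ge0 : 0 <= expR (2 * e) - 1.
  by rewrite subr_ge0 -expR0 ler_expR mulr_ge0.
apply: integral_le_scaled_posterior_density.
- by rewrite mulr_ge0// fine_ge0.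
- exact: measurableT_comp.
- by move=> t; exact: abse_ge0.
- apply: filterS2 Qq posterior_density_dist => t Qt p12.
  by rewrite /= lee_fin normrM -mulrA ler_pM.
Qed.

End comparison.

Theorem proposition2p6 (R : realType) (d : measure_display)
    (Theta : measurableType d) (mu0 : probability Theta R) (m : nat)
    (GN : nat -> Theta -> 'cV[R]_m) (G : Theta -> 'cV[R]_m)
    (mGN : forall N, measurable_fun [set: Theta] (GN N : Theta -> borel_cV R m))
    (mG : measurable_fun [set: Theta] (G : Theta -> borel_cV R m))
    (y : 'cV[R]_m) (Gamma : 'M[R]_m) (Gamma_spd : symposdef Gamma)
    (delta : nat -> R) (M : R)
    (delta_ge0 : forall N, 0 <= delta N) (M_ge0 : 0 <= M)
    (GN_G : forall N,
      ('N[mu0]_+oo[(fun t => (enorm (GN N t - G t))%:E)] <= (delta N)%:E)%E)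
    (GN_y : forall N,
      ('N[mu0]_+oo[(fun t =>
         (Num.max (enorm (GN N t - y)) (enorm (G t - y)))%:E)] <= M%:E)%E) :
  let LN N := misfit Gamma y (GN N) in
  let L := misfit Gamma y G in
  let eps N := M * specnorm (invmx Gamma) * delta N in
  let ZN N := evidence mu0 (LN N) in
  let Z := evidence mu0 L in
  let piN N : probability Theta R :=
    posterior mu0 (measurable_misfit Gamma y (mGN N)) (misfit_ge0 Gamma y (GN N)) in
  let pi : probability Theta R :=
    posterior mu0 (measurable_misfit Gamma y mG) (misfit_ge0 Gamma y G) in
  forall N,
    ('N[mu0]_+oo[(fun t => (LN N t - L t)%:E)] <= (eps N)%:E)%E /\
    (0 < ZN N < +oo)%E /\
    expR (- eps N) <= fine (ZN N) / fine Z <= expR (eps N) /\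
    (tv_dist mu0 (piN N) pi <= (2^-1 * (expR (2 * eps N) - 1))%:E)%E /\
    (hellinger_dist mu0 (piN N) pi <=
       ((Num.sqrt 2)^-1 * (expR (eps N) - 1))%:E)%E /\
    (forall Q : Theta -> R, measurable_fun [set: Theta] Q -> bounded_fun Q ->
      (`| 'E_(piN N)[Q] - 'E_pi[Q] | <=
         'N[mu0]_+oo[EFin \o Q] * (expR (2 * eps N) - 1)%:E)%E).
Proof.
move=> LN L eps ZN Z piN pi N.
have close : {ae mu0, forall t, `|LN N t - L t| <= eps N}.
  have /Lnorm_inftyP ae_delta := GN_G N; have /Lnorm_inftyP ae_M := GN_y N.
  apply: filterS2 ae_delta ae_M => t.
  rewrite !lee_fin => /(le_trans (ler_norm _)) t_delta.
  move=> /(le_trans (ler_norm _)) t_M.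
  rewrite (le_trans (misfit_dist_le _ _ _ _ _))// ler_pM ?enorm_ge0//.
    by rewrite mulr_ge0 ?specnorm_ge0// le_max enorm_ge0.
  by rewrite ler_wpM2r ?specnorm_ge0.
have eps_ge0 : 0 <= eps N by rewrite !mulr_ge0 ?specnorm_ge0.
have mLN := measurable_misfit Gamma y (mGN N).
have mL := measurable_misfit Gamma y mG.
have LN_ge0 := misfit_ge0 Gamma y (GN N).
have L_ge0 := misfit_ge0 Gamma y G.
split; first by apply/Lnorm_inftyP; apply: filterS close => t; rewrite lee_fin.
split.
  rewrite evidence_gt0//=; apply: (le_lt_trans (evidence_le1 mu0 mLN LN_ge0)).
  exact: ltry.
split; first exact: evidence_ratio_bounds.
split; first exact: tv_dist_posterior_le.
split; first exact: hellinger_dist_posterior_le.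
by move=> Q mQ bQ; exact: expectation_posterior_dist_le.
Qed.
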